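(* For any two finite simple graphs $F$ and $G$, $$\operatorname{coind}(B(F\times G))=\min\{\operatorname{coind}(B(F)),\operatorname{coind}(B(G))\}.$$
   Context: The direct (categorical) product $F\times G$ has vertex set $V(F)\times V(G)$, with $(f_1,g_1)$ adjacent to $(f_2,g_2)$ iff $\{f_1,f_2\}\in E(F)$ and $\{g_1,g_2\}\in E(G)$. For a graph $H$, the box complex $B(H)$ is the simplicial complex with vertex set $V(H)\times\{1\}\cup V(H)\times\{2\}$. For $A,B\subseteq V(H)$ write $A\uplus B:=A\times\{1\}\cup B\times\{2\}$. Then $A\uplus B$ is a simplex of $B(H)$ iff every vertex of $A$ is adjacent to every vertex of $B$, and in addition, if $A=\emptyset$ then the vertices of $B$ have a common neighbor in $H$, and if $B=\emptyset$ then the vertices of $A$ have a common neighbor in $H$. Its geometric realization is a $\mathbb{Z}_2$-space with the free involution induced by $A\uplus B\mapsto B\uplus A$. For a $\mathbb{Z}_2$-space $T$, $\operatorname{coind}(T)$ is the largest $h$ such that there is a continuous $\mathbb{Z}_2$-equivariant map from $\mathbb{S}^h$ (with the antipodal involution) to $T$ (with the standard convention that the coindex of the empty space is $-1$). *)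

(* Defs.v *)
From HB Require Import structures.
From mathcomp Require Import all_boot all_order all_algebra.
From mathcomp Require Import all_classical all_reals all_analysis.

Set Implicit Arguments.
Unset Strict Implicit.
Unset Printing Implicit Defensive.

Import Order.TTheory GRing.Theory Num.Theory.
Import numFieldNormedType.Exports.

Local Open Scope classical_set_scope.
Local Open Scope ring_scope.

Record sgraph := SGraph {
  vertex :> finType;
  adj : rel vertex;
  adj_sym : symmetric adj;
  adj_irr : irreflexive adj
}.

Section DirectProduct.
Variables F G : sgraph.

Definition prod_adj : rel (F * G)%type :=
  fun p q => adj p.1 q.1 && adj p.2 q.2.

Lemma prod_adj_sym : symmetric prod_adj.
Proof. by move=> p q; rewrite /prod_adj adj_sym (adj_sym p.2). Qed.

Lemma prod_adj_irr : irreflexive prod_adj.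
Proof. by move=> p; rewrite /prod_adj adj_irr. Qed.

Definition direct_product : sgraph := SGraph prod_adj_sym prod_adj_irr.

End DirectProduct.

Record simplicial_complex (V : finType) := SimplicialComplex {
  simplices : {set {set V}};
  simplices_down : forall s t : {set V},
    s \in simplices -> t \subset s -> t \in simplices
}.

Record Z2Space := MkZ2Space {
  z2_space :> topologicalType;
  z2_inv : z2_space -> z2_space;
  z2_invK : involutive z2_inv;
  z2_inv_cont : continuous z2_inv
}.

Definition z2_map (X Y : Z2Space) (f : X -> Y) : Prop :=
  continuous f /\ forall x, f (z2_inv x) = z2_inv (f x).

(* An invariant subset of a topological space with a continuous involution,
   with the subspace topology. *)
Section InvariantSubspace.
Variables (X : topologicalType) (nu : X -> X) (A : set X).
Hypotheses (nuK : involutive nu) (nu_cont : continuous nu).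
Hypothesis nuA : forall x, A x -> A (nu x).

Definition restr_inv (x : A) : A := SigSub (mem_set (nuA (set_valP x))).

Lemma restr_invK : involutive restr_inv.
Proof. by move=> x; apply: val_inj; rewrite /= nuK. Qed.

Lemma restr_inv_cont : continuous restr_inv.
Proof.
apply/continuousP => _ [U oU <-]; exists (nu @^-1` U) => //.
by move/continuousP: nu_cont; apply.
Qed.

Definition invariant_subspace : Z2Space :=
  MkZ2Space restr_invK restr_inv_cont.

End InvariantSubspace.

Section Sphere.
Variables (R : realType) (n : nat).

Definition unit_sphere : set 'rV[R]_n :=
  [set x | \sum_(i < n) x ord0 i ^+ 2 = 1].

Lemma rV_opp_cont : continuous (-%R : 'rV[R]_n -> 'rV[R]_n).
Proof.
move=> x A [P Px PA]; exists (fun i j => -%R @^-1` P i j).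
  move=> i j; have := Px i j; rewrite mxE; exact: (@opp_continuous R).
by move=> M MP; apply: PA => i j; rewrite mxE; apply: MP.
Qed.

Lemma unit_sphere_opp (x : 'rV[R]_n) : unit_sphere x -> unit_sphere (- x).
Proof.
by rewrite /unit_sphere /= => <-; apply: eq_bigr => i _; rewrite mxE sqrrN.
Qed.

(* The sphere of dimension n - 1 with the antipodal involution; it is empty
   for n = 0. *)
Definition sphere : Z2Space :=
  @invariant_subspace 'rV[R]_n -%R unit_sphere (@opprK _)
    rV_opp_cont unit_sphere_opp.

End Sphere.

Section Coindex.
Variables (R : realType) (T : Z2Space).

Definition sphere_maps (n : nat) : Prop :=
  exists f : sphere R n -> T, z2_map f.

Definition largest_sphere (n : nat) : Prop :=
  sphere_maps n /\ forall m, sphere_maps m -> (m <= n)%N.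

(* The empty sphere (n = 0) maps to every space, so the empty space gets -1.
   The default +oo is only reached when there are maps from spheres of
   arbitrarily large dimension. *)
Definition coind : \bar int :=
  xget +oo%E [set c | exists2 n, largest_sphere n & c = (n%:Z - 1)%:E].

End Coindex.

Lemma ptws_cont (I : eqType) (T X : topologicalType) (h : X -> {ptws I -> T}) :
  (forall i, continuous (fun x => h x i)) -> continuous h.
Proof.
move=> hc x; apply/cvg_sup => v; move: x.
apply/(@continuousP _ (initial_topology (@^~ v))) => _ [B oB <-].
by have /continuousP := hc v; exact.
Qed.

(* A point of the realization is given by its barycentric coordinates, its
   support being a simplex. *)
Section Realization.
Variables (R : realType) (V : finType) (K : simplicial_complex V).

Definition realization : set {ptws V -> R} :=
  [set x | [/\ forall v, 0 <= x v, \sum_v x v = 1 &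
               [set v | x v != 0]%SET \in simplices K]].

Variable nu : V -> V.
Hypothesis nuK : involutive nu.
Hypothesis nu_simplicial :
  forall s : {set V}, s \in simplices K -> [set nu v | v in s]%SET \in simplices K.

(* The affine extension of the vertex map nu sends x to x \o nu^-1, and
   nu^-1 = nu. *)
Definition coord_inv (x : {ptws V -> R}) : {ptws V -> R} := fun v => x (nu v).

Lemma coord_invK : involutive coord_inv.
Proof. by move=> x; apply/funext => v; rewrite /coord_inv nuK. Qed.

Lemma coord_inv_cont : continuous coord_inv.
Proof.
apply: ptws_cont => v; exact: (@proj_continuous V (fun=> R) (nu v)).
Qed.

Lemma realization_inv x : realization x -> realization (coord_inv x).
Proof.
move=> [x0 x1 xK]; split=> [v||]; first exact: x0.
  by rewrite -x1 [RHS](reindex_inj (inv_inj nuK)).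
suff -> : [set v | coord_inv x v != 0]%SET
        = [set nu v | v in [set v | x v != 0]]%SET by exact: nu_simplicial.
apply/setP => v; rewrite inE; apply/idP/imsetP => [xv|[w + ->]].
  by exists (nu v); rewrite ?inE ?nuK.
by rewrite inE /coord_inv nuK.
Qed.

Definition realization_z2 : Z2Space :=
  invariant_subspace coord_invK coord_inv_cont realization_inv.

End Realization.

Section BoxComplex.
Variable H : sgraph.

(* The copies V(H) x {1} and V(H) x {2} are the two fibres over
   false and true. *)
Definition uplus (A B : {set H}) : {set (H * bool)%type} :=
  finset.setX A [set false]%SET :|: finset.setX B [set true]%SET.

Definition common_neighbor (A : {set H}) : bool :=
  [exists w, [forall a in A, adj a w]].

Definition box_simplex (A B : {set H}) : bool :=
  [&& [forall a in A, [forall b in B, adj a b]],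
      (A == finset.set0) ==> common_neighbor B &
      (B == finset.set0) ==> common_neighbor A].

Definition box_simplices : {set {set (H * bool)%type}} :=
  [set s | [exists A, [exists B, box_simplex A B && (s == uplus A B)]]]%SET.

Lemma uplusP (s : {set (H * bool)%type}) :
  s = uplus [set a | (a, false) \in s]%SET [set b | (b, true) \in s]%SET.
Proof.
by apply/setP => -[v []]; rewrite !inE /= ?andbT ?andbF ?orbF ?orFb.
Qed.

Lemma mem_uplus (A B : {set H}) v i :
  ((v, i) \in uplus A B) = if i then v \in B else v \in A.
Proof. by case: i; rewrite !inE /= ?andbT ?andbF ?orbF. Qed.

Lemma common_neighbor_sub (A B : {set H}) :
  A \subset B -> common_neighbor B -> common_neighbor A.
Proof.
move=> /fintype.subsetP AB /existsP[w /forall_inP wB]; apply/existsP; exists w.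
by apply/forall_inP => a /AB; apply: wB.
Qed.

Lemma box_simplex_common (A B : {set H}) : box_simplex A B ->
  common_neighbor A /\ common_neighbor B.
Proof.
move=> /and3P[/forall_inP AB A0 B0]; split.
- have [/eqP BE|[b bB]] := set_0Vmem B; first by move: B0; rewrite BE.
  apply/existsP; exists b; apply/forall_inP => a /AB /forall_inP; exact.
have [/eqP AE|[a aA]] := set_0Vmem A; first by move: A0; rewrite AE.
apply/existsP; exists a; apply/forall_inP => b bB; rewrite adj_sym.
by move/forall_inP: (AB a aA); apply.
Qed.

Lemma box_simplex_sub (A B A' B' : {set H}) :
  A' \subset A -> B' \subset B -> box_simplex A B -> box_simplex A' B'.
Proof.
move=> sA sB AB; have [cA cB] := box_simplex_common AB.
apply/and3P; split; last 2 first.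
- by apply/implyP => _; exact: common_neighbor_sub cB.
- by apply/implyP => _; exact: common_neighbor_sub cA.
case/and3P: AB => /forall_inP AB _ _.
apply/forall_inP => a /(fintype.subsetP sA)/AB/forall_inP aB.
by apply/forall_inP => b /(fintype.subsetP sB)/aB.
Qed.

Lemma box_simplices_down (s t : {set (H * bool)%type}) :
  s \in box_simplices -> t \subset s -> t \in box_simplices.
Proof.
rewrite !inE => /existsP[A /existsP[B /andP[AB /eqP ->]]] /fintype.subsetP ts.
apply/existsP; exists [set a | (a, false) \in t]%SET.
apply/existsP; exists [set b | (b, true) \in t]%SET.
rewrite -uplusP eqxx andbT; apply: box_simplex_sub AB.
  by apply/fintype.subsetP => v; rewrite inE => /ts; rewrite mem_uplus.
by apply/fintype.subsetP => v; rewrite inE => /ts; rewrite mem_uplus.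
Qed.

Definition box_complex : simplicial_complex (H * bool)%type :=
  SimplicialComplex box_simplices_down.

Definition box_swap (p : H * bool) : H * bool := (p.1, ~~ p.2).

Lemma box_swapK : involutive box_swap.
Proof. by case=> v i; rewrite /box_swap /= negbK. Qed.

Lemma box_swap_uplus (A B : {set H}) :
  [set box_swap p | p in uplus A B]%SET = uplus B A.
Proof.
apply/setP => -[v i]; apply/imsetP/idP => [[[w j] wj [-> ->]]|vi].
  by move: wj; rewrite !mem_uplus; case: j.
exists (v, ~~ i); last by rewrite /box_swap /= negbK.
by move: vi; rewrite !mem_uplus; case: i.
Qed.

Lemma box_simplex_sym (A B : {set H}) : box_simplex A B -> box_simplex B A.
Proof.
case/and3P=> /forall_inP AB A0 B0; apply/and3P; split=> //.
apply/forall_inP => b bB; apply/forall_inP => a /AB/forall_inP/(_ b bB).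
by rewrite adj_sym.
Qed.

Lemma box_swap_simplicial (s : {set (H * bool)%type}) :
  s \in simplices box_complex ->
  [set box_swap p | p in s]%SET \in simplices box_complex.
Proof.
rewrite !inE => /existsP[A /existsP[B /andP[AB /eqP ->]]].
apply/existsP; exists B; apply/existsP; exists A.
by rewrite box_simplex_sym // box_swap_uplus eqxx.
Qed.

Definition box_space (R : realType) : Z2Space :=
  realization_z2 R box_swapK box_swap_simplicial.

End BoxComplex.

(* Main.v *)
(* Both projections of F x G are graph homomorphisms, so an equivariant map to
   B(F x G) yields equivariant maps to B(F) and B(G).  Conversely, if p, p' are
   the weights on the two copies of V(F) of a point of B(F), and q, q' those of
   a point of B(G), then (p (x) q, p' (x) q') is, up to normalisation, a point
   of B(F x G), provided none of p, p', q, q' vanishes.  The map [spread] below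
   is an equivariant self-map of B(H) (up to normalisation) after which both
   copies carry positive mass, so it reduces everything to that case.  No
   Borsuk-Ulam theorem is needed: if all spheres map to a box complex, then its
   coindex is +oo on either side of the identity. *)
Require Import Defs.
From mathcomp Require Import all_boot all_order all_algebra.
From mathcomp Require Import all_classical all_reals all_analysis.
From mathcomp Require Import lra.

Set Implicit Arguments.
Unset Strict Implicit.
Unset Printing Implicit Defensive.

Import Order.TTheory GRing.Theory Num.Theory.
Import numFieldNormedType.Exports.

Local Open Scope classical_set_scope.
Local Open Scope ring_scope.

(** * Continuity of finite sums and products and of maps into subspaces and matrices *)

Section Continuity.
Variables (R : realType) (T : topologicalType).

Lemma continuous_maxr (f g : T -> R) :
  continuous f -> continuous g -> continuous (fun x => Num.max (f x) (g x)).
Proof. by move=> cf cg x; apply: (@continuous_max R _ f g x); [exact: cf|exact: cg]. Qed.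

Lemma continuous_sumr (I : finType) (P : pred I) (f : I -> T -> R) :
  (forall i, continuous (f i)) -> continuous (fun x => \sum_(i | P i) f i x).
Proof.
by move=> cf; apply: continuous_big => [|i _]; [exact: add_continuous|exact: cf].
Qed.

Lemma continuous_prodr (I : finType) (P : pred I) (f : I -> T -> R) :
  (forall i, continuous (f i)) -> continuous (fun x => \prod_(i | P i) f i x).
Proof.
by move=> cf; apply: continuous_big => [|i _]; [exact: mul_continuous|exact: cf].
Qed.

Lemma continuous_sig (X : topologicalType) (A : set X) (f : T -> A) :
  continuous (fun x => \val (f x)) -> continuous f.
Proof. exact: continuous_comp_initial. Qed.

Lemma continuous_val (X : topologicalType) (A : set X) :
  continuous (fun x : A => \val x).
Proof. exact: initial_continuous. Qed.

(** A neighborhood of a matrix contains an entrywise box [P], and finitely many entrywise conditions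
    that hold near [x] hold there simultaneously. *)
Lemma continuous_mx m n (f : T -> 'M[R]_(m, n)) :
  (forall i j, continuous (fun x => f x i j)) -> continuous f.
Proof.
move=> cf x A [P Px PA].
have : \forall y \near x, forall i j, P i j (f y i j).
  by apply: filter_forall => i; apply: filter_forall => j; apply: cf.
by apply: filterS => y Py; apply: PA.
Qed.

End Continuity.

(** * Points of a box complex, and equivariant maps given by unnormalised weights *)

Section BoxPoints.
Variables (R : realType) (H : sgraph).

Lemma mem_box_complex (s : {set (H * bool)%type}) :
  (s \in simplices (box_complex H)) =
  box_simplex [set a | (a, false) \in s]%SET [set b | (b, true) \in s]%SET.
Proof.
rewrite inE; apply/existsP/idP => [[A /existsP[B /andP[AB /eqP ->]]]|sH].
  by apply: box_simplex_sub AB; apply/fintype.subsetP => v; rewrite inE mem_uplus.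
by eexists; apply/existsP; eexists; apply/andP; split; [exact: sH|rewrite -uplusP].
Qed.

Definition bary (x : box_space H R) : H * bool -> R := \val x.

Lemma continuous_bary (T : topologicalType) (f : T -> box_space H R) p :
  continuous f -> continuous (fun t => bary (f t) p).
Proof.
move=> cf t; apply: (continuous_comp (g := bary^~ p)); first exact: cf.
have cp : continuous (fun y : {ptws (H * bool)%type -> R} => y p).
  exact: (@proj_continuous _ (fun=> R) p).
exact: continuous_comp (@continuous_val _ (realization (box_complex H)) _) (cp _).
Qed.

(** Dividing by the total weight gives barycentric coordinates: the total is positive, continuous
    and invariant under the involution, and the division creates no new support. *)
Lemma box_map_of_weights (X : Z2Space) (h : X -> H * bool -> R) :
  (forall p, continuous (h^~ p)) -> (forall x p, 0 <= h x p) ->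
  (forall x, exists p, h x p != 0) ->
  (forall x, box_simplex [set a | h x (a, false) != 0]%SET
                         [set b | h x (b, true) != 0]%SET) ->
  (forall x p, h (z2_inv x) p = h x (box_swap p)) ->
  exists f : X -> box_space H R, z2_map f.
Proof.
move=> hC h0 hN hB hI; pose s x := \sum_p h x p.
have s_gt0 x : 0 < s x.
  have [p px] := hN x; rewrite /s (bigD1 p) //= ltr_pwDl ?sumr_ge0 //.
  by rewrite lt_def px h0.
pose g x : {ptws (H * bool)%type -> R} := fun p => h x p / s x.
have gK x : realization (box_complex H) (g x).
  split=> [p||]; first by rewrite divr_ge0 // ltW // s_gt0.
    by rewrite /g -mulr_suml divff // gt_eqF // s_gt0.
  rewrite mem_box_complex; apply: box_simplex_sub (hB x);
    by apply/fintype.subsetP => v; rewrite !inE /g mulf_eq0 => /norP[].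
exists (fun x => SigSub (mem_set (gK x))); split=> [|x].
  apply: continuous_sig; apply: ptws_cont => p x; apply: cvgM; first exact: hC.
  by apply: cvgV; [rewrite gt_eqF // s_gt0|exact: continuous_sumr].
apply: val_inj => /=; apply/funext => p; rewrite /g /coord_inv /s hI.
congr (_ / _); rewrite [RHS](reindex_inj (inv_inj (@box_swapK H))).
by apply: eq_bigr => q _; rewrite hI.
Qed.

Lemma box_point_adj (x : box_space H R) i a b :
  bary x (a, i) != 0 -> bary x (b, ~~ i) != 0 -> adj a b.
Proof.
have [_ _] := set_valP x; rewrite mem_box_complex => /and3P[/forall_inP AB _ _].
have adjF v w : bary x (v, false) != 0 -> bary x (w, true) != 0 -> adj v w.
  by move=> xv xw; have /forall_inP := AB v ltac:(by rewrite !inE); apply; rewrite !inE.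
by case: i => /= xa xb; [rewrite adj_sym|]; apply: adjF.
Qed.

(** If the other side carries weight, any vertex of its support serves as [w]; otherwise the
    definition of the box complex provides one. *)
Lemma box_point_common (x : box_space H R) i :
  exists w, forall v, bary x (v, i) != 0 -> adj v w.
Proof.
have [_ _] := set_valP x; rewrite mem_box_complex => /box_simplex_common[].
move=> /existsP[w /forall_inP wA] /existsP[u /forall_inP uB].
by case: i; [exists u => v xv; apply: uB|exists w => v xv; apply: wA]; rewrite !inE.
Qed.

(** * The equivariant self-map that fills both sides *)

Definition mass (x : H * bool -> R) i := \sum_v x (v, i).

(* Positive only on the heavier side, and then smaller than the largest weight
   on that side. *)
Definition threshold x i := Num.max 0 (mass x i - mass x (~~ i)) / #|H|.+1%:R.

(* Weights are cut off at the threshold; in addition, when side i is the lighter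
   one, a vertex gets new weight on it exactly when it is adjacent to all the
   vertices whose weight on the other side reaches the threshold there.  A common
   neighbor of the heavier side is such a vertex, so an empty side gets filled. *)
Definition spread x (p : H * bool) :=
  Num.max 0 (x p - threshold x p.2) +
  \prod_(v | ~~ adj v p.1) Num.max 0 (threshold x (~~ p.2) - x (v, ~~ p.2)).

Lemma threshold_ge0 x i : 0 <= threshold x i.
Proof. by rewrite divr_ge0 // le_max lexx. Qed.

Lemma threshold_gt0N x i : 0 < threshold x i -> threshold x (~~ i) = 0.
Proof.
rewrite /threshold pmulr_lgt0 ?invr_gt0 // lt_max ltxx /= subr_gt0 negbK => lt_m.
by rewrite max_l ?mul0r // subr_le0 ltW.
Qed.

Lemma maxr0_neq0 (a b : R) : (Num.max 0 (a - b) != 0) = (b < a).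
Proof. by rewrite -subr_gt0; case: ltgtP => //; rewrite ?eqxx // => /gt_eqF ->. Qed.

Lemma spread_ge0 x p : 0 <= spread x p.
Proof. by rewrite addr_ge0 ?prodr_ge0 // => *; rewrite le_max lexx. Qed.

Lemma spread_neq0 x w i : (spread x (w, i) != 0) =
  (threshold x i < x (w, i)) ||
  [forall v, ~~ adj v w ==> (x (v, ~~ i) < threshold x (~~ i))].
Proof.
rewrite paddr_eq0 ?prodr_ge0 //=; last 2 first.
- by rewrite le_max lexx.
- by move=> *; rewrite le_max lexx.
rewrite negb_and maxr0_neq0; congr (_ || _).
apply/prodf_neq0/forall_inP => [h v vw|h v vw]; last by rewrite maxr0_neq0 h.
by rewrite -maxr0_neq0 h.
Qed.

Lemma mass_swap (x y : H * bool -> R) i :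
  (forall p, y p = x (box_swap p)) -> mass y i = mass x (~~ i).
Proof. by move=> yx; apply: eq_bigr => v _; rewrite yx. Qed.

Lemma threshold_swap (x y : H * bool -> R) i :
  (forall p, y p = x (box_swap p)) -> threshold y i = threshold x (~~ i).
Proof. by move=> yx; rewrite /threshold !(mass_swap _ yx). Qed.

Lemma spread_swap (x y : H * bool -> R) p :
  (forall p, y p = x (box_swap p)) -> spread y p = spread x (box_swap p).
Proof.
move=> yx; rewrite /spread !(threshold_swap _ yx) yx; congr (_ + _).
by apply: eq_bigr => v _; rewrite yx.
Qed.

(** Two weights surviving the cut-off come from a simplex. A survivor is adjacent to a filled-in
    vertex on the other side, since the non-neighbors of the latter lie below the threshold. *)
Lemma spread_adj (x : box_space H R) i a b :
  spread (bary x) (a, i) != 0 -> spread (bary x) (b, ~~ i) != 0 -> adj a b.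
Proof.
have [x0 _ _] := set_valP x.
have pos p j : threshold (bary x) j < bary x p -> bary x p != 0.
  by move=> h; rewrite gt_eqF // (le_lt_trans (threshold_ge0 _ _) h).
rewrite !spread_neq0 negbK => /orP[xa|/forall_inP ha] /orP[xb|/forall_inP hb].
- exact: box_point_adj (pos _ _ xa) (pos _ _ xb).
- by apply: contraLR xa => /hb xa; rewrite -leNgt ltW.
- by apply: contraLR xb; rewrite adj_sym => /ha xb; rewrite -leNgt ltW.
(* Both vertices cannot be filled in: each is its own non-neighbor, so both thresholds would exceed
   a nonnegative weight, whereas at most one threshold is positive. *)
have /ha xa := negbT (adj_irr a); have /hb xb := negbT (adj_irr b).
have := threshold_gt0N (le_lt_trans (x0 _) xb).
by move=> h; move: xa; rewrite h ltNge x0.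
Qed.

Lemma spread_side (x : box_space H R) i :
  exists w, spread (bary x) (w, i) != 0.
Proof.
have [x0 x1 _] := set_valP x.
have m0 j : 0 <= mass (bary x) j by apply: sumr_ge0.
have m1 : mass (bary x) i + mass (bary x) (~~ i) = 1.
  rewrite -x1 (eq_bigr (fun p => bary x (p.1, p.2))) => [|[]//].
  rewrite -(pair_bigA _ (fun v j => bary x (v, j))) -big_split /=.
  by apply: eq_bigr => v _; rewrite big_bool; case: i; rewrite //= addrC.
have [mi|mi] := eqVneq (mass (bary x) i) 0.
  (* All the mass is on the other side, whose threshold is thus positive; every non-neighbor of the
     common neighbor [w] has weight 0 there. *)
  have [w hw] := box_point_common x (~~ i); exists w.
  rewrite spread_neq0; apply/orP; right; apply/forall_inP => v vw.
  have -> : bary x (v, ~~ i) = 0.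
    by apply/eqP; apply: contraNT vw; apply: hw.
  have mN : mass (bary x) (~~ i) = 1 by rewrite -m1 mi add0r.
  by rewrite divr_gt0 // lt_max negbK mi mN subr0 ltr01 orbT.
have {}mi : 0 < mass (bary x) i by rewrite lt_def mi m0.
suff [w xw] : exists w, threshold (bary x) i < bary x (w, i).
  by exists w; rewrite spread_neq0 xw.
apply/existsP; apply: contraPT mi; rewrite negb_exists => /forallP h.
apply/negP; rewrite -leNgt.
(* If no weight on side [i] exceeds its threshold [t], the mass is at most [#|H|] times [t]; the
   successor in the denominator makes it at least [#|H|.+1] times [t]. Hence [t] and the mass
   vanish. *)
have le_m : mass (bary x) i <= threshold (bary x) i *+ #|H|.
  by rewrite -sumr_const ler_sum // => v _; rewrite leNgt h.
have : threshold (bary x) i * #|H|.+1%:R <= mass (bary x) i.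
  by rewrite mulfVK // ge_max m0 lerBlDr lerDl m0.
rewrite -natr1 mulrDr mulr1 mulr_natr => le_t.
have t0 : threshold (bary x) i = 0.
  by apply/le_anti; rewrite threshold_ge0 andbT; lra.
by move: le_m; rewrite t0 mul0rn.
Qed.

Section ContinuousSpread.
Variables (T : topologicalType) (x : T -> H * bool -> R).
Hypothesis cx : forall p, continuous (x^~ p).

Lemma continuous_threshold i : continuous (fun t => threshold (x t) i).
Proof.
have cm j : continuous (fun t => mass (x t) j) by apply: continuous_sumr => v.
move=> t; apply: cvgM; last exact: cvg_cst.
move: t; apply: continuous_maxr => t; first exact: cvg_cst.
by apply: cvgB; exact: cm.
Qed.

Lemma continuous_spread p : continuous (fun t => spread (x t) p).
Proof.
move=> t; apply: cvgD; move: t.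
  apply: continuous_maxr => t; first exact: cvg_cst.
  by apply: cvgB; [exact: cx|exact: continuous_threshold].
apply: continuous_prodr => v; apply: continuous_maxr => t; first exact: cvg_cst.
by apply: cvgB; [exact: continuous_threshold|exact: cx].
Qed.

End ContinuousSpread.

End BoxPoints.

(** * Maps into box complexes of products, and maps induced by homomorphisms *)

Section ProductMaps.
Variables (R : realType) (X : Z2Space).

(** The common-neighbor clauses concern empty sides only; this is what filling both sides with
    [spread] gains. *)
Lemma box_simplex_of_adj (H : sgraph) (A B : {set H}) :
  A != finset.set0 -> B != finset.set0 ->
  {in A & B, forall a b, adj a b} -> box_simplex A B.
Proof.
move=> /negbTE A0 /negbTE B0 AB; rewrite /box_simplex A0 B0 !andbT.
by apply/forall_inP => a aA; apply/forall_inP => b bB; apply: AB.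
Qed.

Lemma box_map_prod (F G : sgraph) (f : X -> box_space F R) (g : X -> box_space G R) :
  z2_map f -> z2_map g ->
  exists h : X -> box_space (direct_product F G) R, z2_map h.
Proof.
move=> [cf fI] [cg gI].
(* The tensor product is taken on each side separately; a nonzero entry has both factors nonzero, so
   adjacency is checked coordinatewise. *)
pose h x (p : F * G * bool) :=
  spread (bary (f x)) (p.1.1, p.2) * spread (bary (g x)) (p.1.2, p.2).
have hside x i : exists p, h x (p, i) != 0.
  have [u fu] := spread_side (f x) i; have [v gv] := spread_side (g x) i.
  by exists (u, v); rewrite mulf_neq0.
apply: (@box_map_of_weights R (direct_product F G) X h).
- have cs (H : sgraph) (k : X -> box_space H R) (p : H * bool) :
      continuous k -> continuous (fun x => spread (bary (k x)) p).
    by move=> ck; apply: continuous_spread => q; exact: continuous_bary.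
  by move=> p x; apply: cvgM; exact: cs.
- by move=> x p; rewrite mulr_ge0 ?spread_ge0.
- by move=> x; have [p hp] := hside x true; exists (p, true).
- move=> x; apply: box_simplex_of_adj.
  + by have [p hp] := hside x false; apply/set0Pn; exists p; rewrite inE.
  + by have [p hp] := hside x true; apply/set0Pn; exists p; rewrite inE.
  move=> p q; rewrite !inE !mulf_eq0 !negb_or => /andP[fp gp] /andP[fq gq].
  by rewrite /= /prod_adj (spread_adj fp fq) (spread_adj gp gq).
- move=> x p; rewrite /h fI gI.
  by congr (_ * _); apply: spread_swap.
Qed.

(** Functoriality of the box complex: weights are pushed forward along [phi]. One side may be empty,
    so common neighbors are transported as well. *)
Lemma box_map_hom (H K : sgraph) (phi : H -> K) (f : X -> box_space H R) :
  (forall a b, adj a b -> adj (phi a) (phi b)) -> z2_map f ->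
  exists g : X -> box_space K R, z2_map g.
Proof.
move=> phi_adj [cf fI].
pose h x (p : K * bool) := \sum_(v | phi v == p.1) bary (f x) (v, p.2).
have pos x p : 0 <= bary (f x) p by have [x0 _ _] := set_valP (f x); exact: x0.
have h_neq0 x p : h x p != 0 ->
    exists v, [/\ phi v = p.1 & bary (f x) (v, p.2) != 0].
  rewrite psumr_neq0 // => /hasP[v _ /andP[/eqP pv xv]].
  by exists v; split=> //; rewrite gt_eqF.
have adjh x i a b : h x (a, i) != 0 -> h x (b, ~~ i) != 0 -> adj a b.
  move=> /h_neq0[v [/= <- xv]] /h_neq0[w [/= <- xw]].
  exact/phi_adj/box_point_adj/xw.
have commonh x i : exists w, forall a, h x (a, i) != 0 -> adj a w.
  have [w hw] := box_point_common (f x) i; exists (phi w) => a.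
  by move=> /h_neq0[v [/= <- xv]]; exact/phi_adj/hw.
apply: (@box_map_of_weights R K X h).
- by move=> p; apply: continuous_sumr => v; exact: continuous_bary.
- by move=> x p; rewrite sumr_ge0.
- move=> x; have [[v i] xv] : exists p, bary (f x) p != 0.
    apply/existsP; apply: contraT; rewrite negb_exists => /forallP x0.
    have [_ x1 _] := set_valP (f x); have := oner_neq0 R.
    by rewrite -x1 big1 ?eqxx // => p _; apply/eqP/negPn/x0.
  exists (phi v, i); rewrite psumr_neq0 //=; apply/hasP; exists v.
    by rewrite mem_index_enum.
  by rewrite eqxx lt_def xv pos.
- move=> x; apply/and3P; split.
  + apply/forall_inP => a; rewrite inE => xa; apply/forall_inP => b.
    by rewrite inE; apply: adjh xa.
  + have [w hw] := commonh x true; apply/implyP => _; apply/existsP; exists w.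
    by apply/forall_inP => a; rewrite inE; apply: hw.
  have [w hw] := commonh x false; apply/implyP => _; apply/existsP; exists w.
  by apply/forall_inP => a; rewrite inE; apply: hw.
by move=> x p; rewrite /h fI.
Qed.

End ProductMaps.

(** * The coindex in terms of the spheres that map to a space *)

Section Coindex.
Variable R : realType.

(** Restrict to an equatorial subsphere, embedded by padding with zeros. *)
Lemma sphere_maps_le (T : Z2Space) m n :
  (m <= n)%N -> sphere_maps R T n -> sphere_maps R T m.
Proof.
move=> /subnKC <-; move: (n - m)%N => k [f [cf fI]].
have inc (x : sphere R m) :
    unit_sphere (R := R) (row_mx (\val x) (0 : 'rV[R]_k)).
  have := set_valP x; rewrite /unit_sphere /= => x1.
  rewrite big_split_ord /= [X in _ + X]big1 => [|i _].
    by rewrite addr0 -[RHS]x1; apply: eq_bigr => i _; rewrite row_mxEl.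
  by rewrite row_mxEr mxE expr0n.
pose j (x : sphere R m) : sphere R (m + k) := SigSub (mem_set (inc x)).
exists (f \o j); split=> [x|x]; last first.
  rewrite /= -fI; congr f; apply: val_inj => /=.
  by rewrite opp_row_mx oppr0.
apply: continuous_comp; last exact: cf.
move: x; apply: continuous_sig; apply: continuous_mx => a b.
rewrite /j /=; case: (splitP b) => b' bE.
  have -> : b = lshift k b' by exact: val_inj.
  under eq_fun do rewrite row_mxEl.
  move=> x; apply: (@continuous_comp _ _ _ _ (fun M : 'rV[R]_m => M a b')).
    exact: continuous_val.
  exact: coord_continuous.
have -> : b = rshift m b' by exact: val_inj.
under eq_fun do rewrite row_mxEr.
exact: cst_continuous.
Qed.

Lemma coind_largest (T : Z2Space) n :
  largest_sphere R T n -> coind R T = (n%:Z - 1)%:E.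
Proof.
move=> [Tn Tmax]; apply: xget_unique; first by exists n.
move=> _ [m [Tm mmax] ->].
by have -> : m = n by apply/eqP; rewrite eqn_leq mmax ?Tmax.
Qed.

Lemma coind_infinite (T : Z2Space) :
  (forall n, sphere_maps R T n) -> coind R T = +oo%E.
Proof.
(* No [n] is largest, so [xget] returns its default [+oo]. *)
move=> Tn; apply: xgetPN => c [n [_ nmax] _].
by have := nmax _ (Tn n.+1); rewrite ltnn.
Qed.

(** The admissible [n] form an initial segment containing 0, where the sphere is empty; if some [n]
    is admissible and [n.+1] is not, then [n] is largest. *)
Lemma largest_sphereVinfinite (T : Z2Space) :
  (exists n, largest_sphere R T n) \/ (forall n, sphere_maps R T n).
Proof.
apply: contrapT => /not_orP[/forallNP nmax]; apply => n.
elim: n => [|n Tn].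
  have e0 (x : sphere R 0) : False.
    by have := set_valP x; rewrite /unit_sphere /= big_ord0; apply/eqP; rewrite eq_sym oner_eq0.
  by exists (fun x => False_rect T (e0 x)); split=> x; case: (e0 x).
apply: contrapT => Tn1; apply: (nmax n); split=> // m Tm.
by rewrite leqNgt; apply/negP => /sphere_maps_le/(_ Tm).
Qed.

Lemma sphere_maps_direct_product (F G : sgraph) n :
  sphere_maps R (box_space (direct_product F G) R) n <->
  sphere_maps R (box_space F R) n /\ sphere_maps R (box_space G R) n.
Proof.
split=> [[h hh]|[[f hf] [g hg]]]; last exact: box_map_prod hf hg.
split.
  by apply: (box_map_hom (H := direct_product F G) (phi := fst) _ hh) => a b /andP[].
by apply: (box_map_hom (H := direct_product F G) (phi := snd) _ hh) => a b /andP[].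
Qed.

(** The admissible [n] for [S] form the intersection of two initial segments, which ends at the
    smaller of their ends; an unbounded segment has coindex [+oo], neutral for the minimum. *)
Lemma coind_min (S T U : Z2Space) :
  (forall n, sphere_maps R S n <-> sphere_maps R T n /\ sphere_maps R U n) ->
  coind R S = Order.min (coind R T) (coind R U).
Proof.
move=> STU.
have [[t tT]|Too] := largest_sphereVinfinite T;
  have [[u uU]|Uoo] := largest_sphereVinfinite U.
- rewrite (coind_largest tT) (coind_largest uU).
  case: tT uU => [Tt tmax] [Uu umax]; case/orP: (leq_total t u) => tu.
    rewrite min_l ?lee_fin ?lerD2r ?lez_nat //; apply: coind_largest.
    split=> [|m /STU[/tmax//]].
    by apply/STU; split=> //; apply: sphere_maps_le Uu.
  rewrite min_r ?lee_fin ?lerD2r ?lez_nat //; apply: coind_largest.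
  split=> [|m /STU[_ /umax//]].
  by apply/STU; split=> //; apply: sphere_maps_le Tt.
- rewrite (coind_infinite Uoo) min_l ?leey // (coind_largest tT).
  apply: coind_largest; case: tT => Tt tmax.
  by split=> [|m /STU[/tmax//]]; apply/STU.
- rewrite (coind_infinite Too) min_r ?leey // (coind_largest uU).
  apply: coind_largest; case: uU => Uu umax.
  by split=> [|m /STU[_ /umax//]]; apply/STU.
rewrite !coind_infinite ?min_l // => n; exact/STU.
Qed.

End Coindex.

Theorem theorem2 (R : realType) (F G : sgraph) :
  coind R (box_space (direct_product F G) R)
  = Order.min (coind R (box_space F R)) (coind R (box_space G R)).
Proof. exact/coind_min/sphere_maps_direct_product. Qed.
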